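(* Let $H(\cdot,\cdot,\cdot)$ be the conditioned generator of the ASEP with periodic boundary conditions, let $\alpha>0$, let $0\le K\le L$ and let $\eta_K\in\Omega_K$ be any configuration with $K$ particles. Then for $0\le n\le L-K$ and for each choice of sign $\pm$ (the same sign throughout) one has the intertwining relation $$\left[(S^\pm(q,\alpha))^n\,H(q,\alpha,q^{2n}\beta^\pm)-H(q,\alpha,\beta^\pm)\,(S^\pm(q,\alpha))^n\right]|\eta_K\rangle=0$$ with $$\beta^\pm=q^{\pm(L-2K)}\,\alpha^{-L}.$$
   Context: Parameters: an integer $L\ge 2$ (number of sites of a ring), an asymmetry $q>0$, $q\neq 1$, a time scale $w\neq 0$. Configurations: $\Omega=\{0,1\}^L$, and $\Omega_K$ is the set of $\eta=(\eta(1),\dots,\eta(L))\in\Omega$ with $\sum_k\eta(k)=K$. To $\eta$ one assigns the basis vector $|\eta\rangle=|\eta(1))\otimes\cdots\otimes|\eta(L))$ of $(\mathbb{C}^2)^{\otimes L}$, where $|0)=(1,0)^T$ and $|1)=(0,1)^T$. One-site matrices: $\sigma^+=\begin{pmatrix}0&1\\0&0\end{pmatrix}$, $\sigma^-=\begin{pmatrix}0&0\\1&0\end{pmatrix}$, $\sigma^z=\begin{pmatrix}1&0\\0&-1\end{pmatrix}$, $\hat n=\begin{pmatrix}0&0\\0&1\end{pmatrix}$, $\hat\upsilon=\begin{pmatrix}1&0\\0&0\end{pmatrix}$; for a one-site matrix $u$, $u_k$ denotes $u$ acting on the $k$-th tensor factor and as the identity on the others. Conditioned (weighted) generator with periodic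 boundary conditions (for $\alpha,\beta>0$): $$H(q,\alpha,\beta)=\sum_{k=1}^{L-1}h_{k,k+1}(q,\alpha)+h_{L,1}(q,\alpha,\beta),$$ $$h_{k,k+1}(q,\alpha)=-w\left[\alpha\,\sigma^+_k\sigma^-_{k+1}-q\,\hat n_k\hat\upsilon_{k+1}+\alpha^{-1}\sigma^-_k\sigma^+_{k+1}-q^{-1}\hat\upsilon_k\hat n_{k+1}\right],$$ $$h_{L,1}(q,\alpha,\beta)=-w\left[\alpha\beta\,\sigma^+_L\sigma^-_{1}-q\,\hat n_L\hat\upsilon_{1}+(\alpha\beta)^{-1}\sigma^-_L\sigma^+_{1}-q^{-1}\hat\upsilon_L\hat n_{1}\right].$$ Generators of the quantum algebra representation: $$S^\pm(q,\alpha)=\sum_{k=1}^L \alpha^{\pm\frac12(L+1-2k)}\,q^{\frac12\sum_{i=1}^{k-1}\sigma^z_i-\frac12\sum_{i=k+1}^{L}\sigma^z_i}\,\sigma^\pm_k .$$ *)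

(* Defs.v *)
From HB Require Import structures.
From mathcomp Require Import all_boot all_order all_algebra.
From mathcomp Require Import mxtens complex.
From mathcomp Require Import all_classical all_reals all_analysis.

Set Implicit Arguments.
Unset Strict Implicit.
Unset Printing Implicit Defensive.

Import Order.TTheory GRing.Theory Num.Theory.
Import numFieldNormedType.Exports.

Local Open Scope ring_scope.

(* Dimension 2^n of the n-fold tensor power, in a form for which the iterated
   Kronecker products below typecheck without casts (2 ^ n.+1 is not
   convertible to 2 * 2 ^ n). *)
Fixpoint tdim (n : nat) : nat := if n is n'.+1 then (2 * tdim n')%N else 1%N.

(* u 0 (x) ... (x) u (n-1); u 0 is the leftmost factor. *)
Fixpoint tensop (F : pzRingType) (n : nat) :
    ('I_n -> 'M[F]_2) -> 'M[F]_(tdim n) :=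
  match n with
  | 0 => fun=> 1%:M
  | n'.+1 => fun u => u ord0 *t tensop (fun i => u (lift ord0 i))
  end.

Fixpoint tensvec (F : pzRingType) (n : nat) :
    ('I_n -> 'cV[F]_2) -> 'cV[F]_(tdim n) :=
  match n with
  | 0 => fun=> 1%:M
  | n'.+1 => fun v => v ord0 *t tensvec (fun i => v (lift ord0 i))
  end.

Section Matrices.
Variable F : pzRingType.

(* With |0) = (1,0)^T (empty) and |1) = (0,1)^T (occupied),
   sigma^+ annihilates and sigma^- creates a particle. *)
Definition sigma_p : 'M[F]_2 := delta_mx 0 1.
Definition sigma_m : 'M[F]_2 := delta_mx 1 0.
Definition sigma_z : 'M[F]_2 := delta_mx 0 0 - delta_mx 1 1.
Definition num_op : 'M[F]_2 := delta_mx 1 1.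
Definition hole_op : 'M[F]_2 := delta_mx 0 0.

(* u_k, with sites numbered 1, ..., L. *)
Definition site (L : nat) (u : 'M[F]_2) (k : nat) : 'M[F]_(tdim L) :=
  tensop (fun i : 'I_L => if i.+1 == k then u else 1%:M).

End Matrices.
Arguments sigma_p {F}.
Arguments sigma_m {F}.
Arguments sigma_z {F}.
Arguments num_op {F}.
Arguments hole_op {F}.

Definition config (L : nat) := {ffun 'I_L -> 'I_2}.

Definition config_num (L K : nat) : {set config L} :=
  [set eta : config L | \sum_(k < L) (eta k : nat) == K]%N.

Definition ket (F : pzRingType) (L : nat) (eta : config L) : 'cV[F]_(tdim L) :=
  tensvec (fun k => delta_mx (eta k) 0).
Arguments ket F {L} eta.

(* Matrix exponential, as the entrywise sum of the exponential series. *)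
Definition expmx (K : numFieldType) (m : nat) (A : 'M[K]_m) : 'M[K]_m :=
  \matrix_(i, j)
    limn (fun N : nat => \sum_(0 <= p < N) (p`!%:R)^-1 * (A ^+ p) i j).

Section ASEP.
Variable R : realType.
Local Notation C := R[i].

(* q^A = exp((ln q) A), for q > 0. *)
Definition powmx (m : nat) (q : R) (A : 'M[C]_m) : 'M[C]_m :=
  expmx ((ln q)%:C%C *: A).

Variable L : nat.

(* h_{k,l} with hopping weight a; the bond (L, 1) below uses
   a = alpha * beta. *)
Definition bond (w q a : R) (k l : nat) : 'M[C]_(tdim L) :=
  (- w)%:C%C *:
    (  a%:C%C      *: (site L sigma_p k *m site L sigma_m l)
     - q%:C%C      *: (site L num_op k *m site L hole_op l)
     + (a^-1)%:C%C *: (site L sigma_m k *m site L sigma_p l)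
     - (q^-1)%:C%C *: (site L hole_op k *m site L num_op l)).

Definition asepH (w q alpha beta : R) : 'M[C]_(tdim L) :=
  \sum_(1 <= k < L) bond w q alpha k k.+1 + bond w q (alpha * beta) L 1.

Inductive pm := Plus | Minus.

(* The sign as an integer factor: +1 or -1. *)
Definition pmz (s : pm) : int := if s is Plus then 1 else -1.

Definition sigma_pm (s : pm) : 'M[C]_2 := if s is Plus then sigma_p else sigma_m.

Definition qS (s : pm) (q alpha : R) : 'M[C]_(tdim L) :=
  \sum_(1 <= k < L.+1)
    (alpha `^ ((pmz s)%:~R * (2^-1 * (L%:R + 1 - 2 * k%:R))))%:C%C *:
    (powmx q (2^-1 *: (\sum_(1 <= i < k) site L sigma_z i)
              - 2^-1 *: (\sum_(k.+1 <= i < L.+1) site L sigma_z i))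
     *m site L (sigma_pm s) k).

Definition beta_pm (s : pm) (q alpha : R) (K : nat) : R :=
  q ^ (pmz s * (L%:Z - 2 * K%:Z)) * alpha ^- L.

End ASEP.

(* Main.v *)
(** Write [S = A + B], where [B] is the summand at the last site [L].  Since
    [B A = q^(+-2) A B] and [B^2 = 0], a truncated q-binomial formula gives
    [S^n = A^n + c_n A^(n-1) B].  The operator [S' = A q^(sigma^z_L) + B'], obtained by
    reading the ring from site [L], commutes with the boundary term
    [h_(L,1)] with plain weight [alpha], for the same reason that [S] commutes
    with the bulk terms.  Comparing the two expansions on the eigenspace
    [sum_k sigma^z_k = L - 2K] gives [S^n G q^(n sigma^z_L) = G S'^n] with a
    diagonal operator [G] at site [L]; conjugating [h_(L,1)] by [G] and by
    [G q^(n sigma^z_L)] produces the weights [alpha beta] and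
    [alpha q^(2n) beta]. *)
Require Import Defs.
From mathcomp Require Import all_boot all_order all_algebra.
From mathcomp Require Import mxtens complex ring.
From mathcomp Require Import all_classical all_reals all_analysis.

Set Implicit Arguments.
Unset Strict Implicit.
Unset Printing Implicit Defensive.

Import Order.TTheory GRing.Theory Num.Theory numFieldNormedType.Exports.
Local Open Scope ring_scope.

(** * Indices of tensor powers as binary words, and entries of product operators *)

Fixpoint digit (n : nat) : 'I_(tdim n) -> 'I_n -> 'I_2 :=
  match n with
  | 0 => fun _ _ => ord0
  | n'.+1 => fun x i =>
      if unlift ord0 i is Some j then digit (mxtens_unindex x).2 j
      else (mxtens_unindex x).1
  end.

Lemma digit_inj (n : nat) (x y : 'I_(tdim n)) : digit x =1 digit y -> x = y.
Proof.
elim: n x y => [|n IHn] x y eq_xy; first by rewrite [x]ord1 [y]ord1.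
rewrite -[x]mxtens_unindexK -[y]mxtens_unindexK; congr mxtens_index.
rewrite [mxtens_unindex x]surjective_pairing.
rewrite [mxtens_unindex y]surjective_pairing; congr (_, _).
  by have := eq_xy ord0; rewrite /= unlift_none.
by apply: IHn => j; have := eq_xy (lift ord0 j); rewrite /= liftK.
Qed.

Lemma digit_neq (n : nat) (x y : 'I_(tdim n)) :
  x != y -> exists i, digit x i != digit y i.
Proof.
move=> neq_xy; apply/existsP; apply: contraNT neq_xy.
rewrite negb_exists => /forallP xy.
by apply/eqP/digit_inj => i; apply/eqP; rewrite -[_ == _]negbK.
Qed.

Section TensorOperators.
Variable F : comPzRingType.
Implicit Types (n : nat).

(** Reduces identities between product operators to scalar products over sites, from which the sites
    of interest can be split off. *)
Lemma tensopE n (u : 'I_n -> 'M[F]_2) x y :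
  tensop u x y = \prod_i u i (digit x i) (digit y i).
Proof.
elim: n u x y => [|n IHn] u x y.
  by rewrite big_ord0 /= [x]ord1 [y]ord1 mxE.
rewrite big_ord_recl mxE IHn /= unlift_none; congr (_ * _).
by apply: eq_bigr => i _; rewrite liftK.
Qed.

Lemma eq_tensop n (u v : 'I_n -> 'M[F]_2) : u =1 v -> tensop u = tensop v.
Proof.
by move=> uv; apply/matrixP => x y; rewrite !tensopE; apply: eq_bigr => i _; rewrite uv.
Qed.

Lemma tensop_mul n (u v : 'I_n -> 'M[F]_2) :
  tensop u *m tensop v = tensop (fun i => u i *m v i).
Proof.
elim: n u v => [|n IHn] u v /=; first by rewrite mulmx1.
by rewrite tensmx_mul IHn.
Qed.

Lemma tensop1 n : tensop (fun _ : 'I_n => 1%:M : 'M[F]_2) = 1%:M.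
Proof.
apply/matrixP => x y; rewrite tensopE !mxE.
have [->|neq_xy] := eqVneq x y.
  by rewrite big1 // => i _; rewrite mxE eqxx.
have [i xy_i] := digit_neq neq_xy.
by rewrite (bigD1 i) //= mxE (negPf xy_i) mul0r.
Qed.

Lemma tensop_scale n (c : 'I_n -> F) (u v : 'I_n -> 'M[F]_2) :
  (forall i, u i = c i *: v i) -> tensop u = (\prod_i c i) *: tensop v.
Proof.
move=> uE; apply/matrixP => x y; rewrite mxE !tensopE -big_split /=.
by apply: eq_bigr => i _; rewrite uE mxE.
Qed.

Lemma tensop_eq0 n (u : 'I_n -> 'M[F]_2) i : u i = 0 -> tensop u = 0.
Proof.
move=> ui0; apply/matrixP => x y.
by rewrite tensopE (bigD1 i) //= ui0 !mxE mul0r.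
Qed.

Lemma tensop_mulvec n (u : 'I_n -> 'M[F]_2) (v : 'I_n -> 'cV[F]_2) :
  tensop u *m tensvec v = tensvec (fun i => u i *m v i).
Proof.
elim: n u v => [|n IHn] u v /=; first by rewrite mulmx1.
have /= <- := IHn (fun i => u (lift ord0 i)) (fun i => v (lift ord0 i)).
exact: (@tensmx_mul _ 2 2 (tdim n) (tdim n) 1 1).
Qed.

Lemma tensvec_scale n (c : 'I_n -> F) (u v : 'I_n -> 'cV[F]_2) :
  (forall i, u i = c i *: v i) -> tensvec u = (\prod_i c i) *: tensvec v.
Proof.
elim: n c u v => [|n IHn] c u v uE /=; first by rewrite big_ord0 scale1r.
rewrite big_ord_recl (IHn (fun i => c (lift ord0 i)) _ (fun i => v (lift ord0 i))) //.
by apply/matrixP => x y; rewrite uE !mxE mulrACA.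
Qed.

End TensorOperators.

(** [B] stands for the bulk, which commutes with [A] as an operator; the boundary terms [X] and [Y]
    carry different weights and are intertwined only on the vector [v]. *)
Lemma intertwineD (F : pzRingType) N (A B X Y : 'M[F]_N) (v : 'cV[F]_N) :
  B *m A = A *m B -> A *m (X *m v) = Y *m (A *m v) ->
  A *m ((B + X) *m v) - (B + Y) *m (A *m v) = 0.
Proof.
move=> BA AX; rewrite !mulmxDl mulmxDr AX !mulmxA BA opprD addrACA !subrr.
by rewrite addr0.
Qed.

(** * Operators at two sites and their intertwining with a bond *)

Section TwoSites.
Variables (F : fieldType) (L : nat).
Implicit Types (u : 'I_L -> 'M[F]_2) (k l : 'I_L) (A B : 'M[F]_2).

(** Two sites are singled out of a background [u]: a bond on [k] and [l] changes only [A] and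
    [B]. *)
Definition place u k l A B : 'M[F]_(tdim L) :=
  tensop (fun i => if i == k then A else if i == l then B else u i).

Definition at_site k A : 'M[F]_(tdim L) :=
  tensop (fun i => if i == k then A else 1%:M).

Lemma siteE A k : site L A k.+1 = at_site k A.
Proof. by apply: eq_tensop => i; rewrite eqSS -val_eqE. Qed.

Lemma placeE u k l A B x y : k != l ->
  place u k l A B x y =
  A (digit x k) (digit y k) * B (digit x l) (digit y l)
  * \prod_(i | (i != k) && (i != l)) u i (digit x i) (digit y i).
Proof.
move=> neq_kl; rewrite tensopE (bigD1 k) //= eqxx (bigD1 l) /=; last by rewrite eq_sym.
rewrite eq_sym (negPf neq_kl) eqxx mulrA; congr (_ * _).
by apply: eq_bigr => i /andP[/negPf-> /negPf->].
Qed.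

Lemma place1 k l A B : k != l ->
  at_site k A *m at_site l B = place (fun=> 1%:M) k l A B.
Proof.
move=> neq_kl; rewrite tensop_mul; apply: eq_tensop => i.
case: eqP => [->|_]; first by rewrite (negPf neq_kl) mulmx1.
by rewrite mul1mx.
Qed.

Lemma place_mulr u k l A B A' B' :
  place u k l A B *m place (fun=> 1%:M) k l A' B' = place u k l (A *m A') (B *m B').
Proof.
by rewrite tensop_mul; apply: eq_tensop => i; case: eqP => // _; case: eqP; rewrite ?mulmx1.
Qed.

Lemma place_mull u k l A B A' B' :
  place (fun=> 1%:M) k l A' B' *m place u k l A B = place u k l (A' *m A) (B' *m B).
Proof.
by rewrite tensop_mul; apply: eq_tensop => i; case: eqP => // _; case: eqP; rewrite ?mul1mx.
Qed.

Variables (w q : F).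

(** The bond of the generator over an arbitrary field, with ordinals as sites; [bondE] links it to
    [bond]. *)
Definition hop (a : F) k l : 'M[F]_(tdim L) :=
  (- w) *: (a *: (at_site k sigma_p *m at_site l sigma_m)
            - q *: (at_site k num_op *m at_site l hole_op)
            + a^-1 *: (at_site k sigma_m *m at_site l sigma_p)
            - q^-1 *: (at_site k hole_op *m at_site l num_op)).

(* The entries of [(A (x) B) h(a) - h(a') (A (x) B)] on two sites, up to the factor [- w]. *)
Definition hop_defect (a a' : F) A B (i j i' j' : 'I_2) : F :=
  a * ((A *m sigma_p) i j * (B *m sigma_m) i' j')
  - q * ((A *m num_op) i j * (B *m hole_op) i' j')
  + a^-1 * ((A *m sigma_m) i j * (B *m sigma_p) i' j')
  - q^-1 * ((A *m hole_op) i j * (B *m num_op) i' j')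
  - (a' * ((sigma_p *m A) i j * (sigma_m *m B) i' j')
  - q * ((num_op *m A) i j * (hole_op *m B) i' j')
  + a'^-1 * ((sigma_m *m A) i j * (sigma_p *m B) i' j')
  - q^-1 * ((hole_op *m A) i j * (num_op *m B) i' j')).

(** Each entry of the difference is a two-site defect times the same background product, so the
    local defect decides. Two summands are allowed because the ladder terms at [k] and at [l] have
    to cancel each other's defects. *)
Lemma hop_intertwine a a' k l u e1 e2 A1 B1 A2 B2 : k != l ->
  (forall i j i' j', e1 * hop_defect a a' A1 B1 i j i' j'
                     + e2 * hop_defect a a' A2 B2 i j i' j' = 0) ->
  (e1 *: place u k l A1 B1 + e2 *: place u k l A2 B2) *m hop a k l
  = hop a' k l *m (e1 *: place u k l A1 B1 + e2 *: place u k l A2 B2).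
Proof.
move=> neq_kl defect0; apply/eqP; rewrite -subr_eq0; apply/eqP.
rewrite /hop !place1 // -scalemxAl -scalemxAr -scalerBr.
rewrite !mulmxDl !mulmxDr !(mulmxN, mulNmx) -!(scalemxAl, scalemxAr).
rewrite !place_mulr !place_mull.
apply/matrixP => x y; rewrite !mxE !placeE //.
set P := \prod_(i | _) _.
rewrite -[RHS](mulr0 (- w * P)) -(defect0 (digit x k) (digit y k) (digit x l) (digit y l)).
by rewrite /hop_defect; ring.
Qed.

Lemma hop_intertwine1 a a' k l u A B : k != l ->
  (forall i j i' j', hop_defect a a' A B i j i' j' = 0) ->
  place u k l A B *m hop a k l = hop a' k l *m place u k l A B.
Proof.
move=> neq_kl defect0.
have := @hop_intertwine a a' k l u 1 0 A B A B neq_kl.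
rewrite !scale0r !addr0 !scale1r; apply => i j i' j'.
by rewrite defect0 !mulr0 addr0.
Qed.

End TwoSites.

(** * One-site matrices and the symmetry of a single bond *)

Section LocalMatrices.
Variables (F : fieldType) (s : pm).

Definition ladder : 'M[F]_2 := if s is Plus then sigma_p else sigma_m.

(** The power with exponent [pmz s], so that both signs share one argument. *)
Definition spow (x : F) : F := if s is Plus then x else x^-1.

(** With [q = r ^+ 2], [diag2 r r^-1] is [q^(sigma^z / 2)] and [diag2 q q^-1] is [q^(sigma^z)]. *)
Definition diag2 (x y : F) : 'M[F]_2 := x *: hole_op + y *: num_op.

Lemma mul_unitmx :
  ((sigma_p *m sigma_p = 0 :> 'M[F]_2) * (sigma_p *m sigma_m = hole_op :> 'M[F]_2)
  * (sigma_p *m hole_op = 0 :> 'M[F]_2) * (sigma_p *m num_op = sigma_p :> 'M[F]_2)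
  * (sigma_m *m sigma_p = num_op :> 'M[F]_2) * (sigma_m *m sigma_m = 0 :> 'M[F]_2)
  * (sigma_m *m hole_op = sigma_m :> 'M[F]_2) * (sigma_m *m num_op = 0 :> 'M[F]_2)
  * (hole_op *m sigma_p = sigma_p :> 'M[F]_2) * (hole_op *m sigma_m = 0 :> 'M[F]_2)
  * (hole_op *m hole_op = hole_op :> 'M[F]_2) * (hole_op *m num_op = 0 :> 'M[F]_2)
  * (num_op *m sigma_p = 0 :> 'M[F]_2) * (num_op *m sigma_m = sigma_m :> 'M[F]_2)
  * (num_op *m hole_op = 0 :> 'M[F]_2) * (num_op *m num_op = num_op :> 'M[F]_2))%type.
Proof.
by rewrite /sigma_p /sigma_m /hole_op /num_op; do !split; rewrite ?mul_delta_mx ?mul_delta_mx_0.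
Qed.

Lemma mul_diag2 x y x' y' : diag2 x y *m diag2 x' y' = diag2 (x * x') (y * y').
Proof.
rewrite /diag2 mulmxDl !mulmxDr -!(scalemxAl, scalemxAr) !mul_unitmx.
by rewrite !scaler0 addr0 add0r !scalerA.
Qed.

Lemma diag2_1 : diag2 1 1 = 1%:M.
Proof.
apply/matrixP => i j; rewrite !mxE.
by case: i => [[|[|//]] ?]; case: j => [[|[|//]] ?]; rewrite /= !mul1r !(addr0, add0r).
Qed.

Lemma mul_diag2_sigma x y :
  ((diag2 x y *m sigma_p = x *: sigma_p) * (diag2 x y *m sigma_m = y *: sigma_m)
  * (diag2 x y *m hole_op = x *: hole_op) * (diag2 x y *m num_op = y *: num_op)
  * (sigma_p *m diag2 x y = y *: sigma_p) * (sigma_m *m diag2 x y = x *: sigma_m)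
  * (hole_op *m diag2 x y = x *: hole_op) * (num_op *m diag2 x y = y *: num_op))%type.
Proof.
rewrite /diag2 !mulmxDl !mulmxDr -!(scalemxAl, scalemxAr) !mul_unitmx.
by rewrite !scaler0 !addr0 !add0r.
Qed.

Lemma ladder2 : ladder *m ladder = 0.
Proof. by rewrite /ladder; case: s; rewrite !mul_unitmx. Qed.

Lemma diag2_ladder x : x != 0 -> diag2 x x^-1 *m ladder = spow x *: ladder.
Proof. by rewrite /ladder /spow; case: s; rewrite !mul_diag2_sigma. Qed.

Lemma ladder_diag2 x : x != 0 -> ladder *m diag2 x x^-1 = (spow x)^-1 *: ladder.
Proof. by rewrite /ladder /spow; case: s; rewrite !mul_diag2_sigma ?invrK. Qed.

(** Diagonal matrices commute with the two diagonal terms of the bond and only rescale its two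
    hopping terms; the hypotheses say that this rescaling turns [a] into [a']. *)
Lemma hop_defect_diag2 q a a' x y x' y' i j i' j' :
  a * (x * y') = a' * (y * x') -> a^-1 * (y * x') = a'^-1 * (x * y') ->
  hop_defect q a a' (diag2 x y) (diag2 x' y') i j i' j' = 0.
Proof.
move=> e1 e2; rewrite /hop_defect !mul_diag2_sigma !mxE.
by ring: e1 e2.
Qed.

(** The quantum algebra symmetry of one bond: the two summands form the coproduct of the ladder
    generator on two sites, with relative coefficient [spow a]. The rate [r ^+ 2] of the bond
    matches the deformation [r] of the diagonal factors. *)
Lemma hop_defect_ladder r a i j i' j' : a != 0 -> r != 0 ->
  spow a * hop_defect (r ^+ 2) a a ladder (diag2 r^-1 r) i j i' j'
  + hop_defect (r ^+ 2) a a (diag2 r r^-1) ladder i j i' j' = 0.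
Proof.
move=> a_neq0 r_neq0.
rewrite /hop_defect /spow /ladder.
case: s; rewrite !mul_diag2_sigma !mul_unitmx !mxE ?(mulr0, mul0r).
  by field; rewrite a_neq0 r_neq0.
by field; rewrite a_neq0 r_neq0.
Qed.

End LocalMatrices.

(** * Powers of sums of q-commuting operators *)

Section QCommutation.
Variables (F : fieldType) (N : nat).
Implicit Types A B U G Z : 'M[F]_N.

Lemma qcomm_expr A B (x : F) n :
  B * A = x *: (A * B) -> B * A ^+ n = x ^+ n *: (A ^+ n * B).
Proof.
move=> BA; elim: n => [|n IHn]; first by rewrite !expr0 scale1r mulr1 mul1r.
rewrite !exprS mulrA BA -[LHS]scalemxAl -mulmxA [B *m _]IHn -scalemxAr scalerA.
by rewrite mulmxE mulrA.
Qed.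

(* The q-binomial theorem, truncated by [B ^+ 2 = 0]. *)
Lemma qcomm_exprDn A B (x : F) n : B * A = x *: (A * B) -> B * B = 0 ->
  (A + B) ^+ n.+1 = A ^+ n.+1 + (\sum_(i < n.+1) x ^+ i) *: (A ^+ n * B).
Proof.
move=> BA BB; elim: n => [|n IHn].
  by rewrite big_ord1 !expr1 !expr0 scale1r mul1r.
rewrite exprS IHn mulrDl !mulrDr -!exprS -!mulmxE -!scalemxAr !mulmxE.
rewrite [B * (_ * _)]mulrA !(qcomm_expr _ BA) -!mulmxE -scalemxAl -mulmxA.
rewrite [B *m B]BB mulmx0 !scaler0 addr0 !mulmxE mulrA -exprS [in RHS]big_ord_recr /= scalerDl.
by rewrite -!addrA.
Qed.

(** Summation in reverse order. It compares the coefficients of two truncated q-binomial expansions,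
    in base [y ^+ 2] and in base [y ^- 2]. *)
Lemma geometric_inv (y : F) n : y != 0 ->
  \sum_(i < n.+1) (y ^+ 2) ^+ i = y ^+ (2 * n) * \sum_(i < n.+1) (y ^- 2) ^+ i.
Proof.
move=> y_neq0; rewrite (reindex_inj rev_ord_inj) /= mulr_sumr.
apply: eq_bigr => i _; rewrite -exprM subSS mulnBr exprB ?unitfE //.
  by rewrite exprVn -exprM.
by rewrite leq_mul2l /= -ltnS.
Qed.

(** Both powers are expanded by [qcomm_exprDn]. The leading terms agree because [A] commutes with
    [U] and [G]. On [v] both remaining terms are multiples of [A ^+ n * B], and after
    [geometric_inv] the coefficients differ only by [phi'] against [phi * nu * zeta]. *)
Lemma twisted_power A B B' U G Z (v : 'cV[F]_N) (y phi phi' nu zeta : F) n :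
  y != 0 ->
  A * U = U * A -> A * G = G * A -> 
  B * A = y ^+ 2 *: (A * B) -> B * B = 0 ->
  B' * (A * U) = y ^- 2 *: (A * U * B') -> B' * B' = 0 ->
  B' = (nu / y) *: (B * Z) -> Z *m v = zeta *: v ->
  B * U = y^-1 *: B -> U * B = y *: B ->
  G * B = phi *: B -> B * G = phi' *: B -> phi' = phi * nu * zeta ->
  (A + B) ^+ n *m (G * U ^+ n *m v) = G *m ((A * U + B') ^+ n *m v).
Proof.
move=> y_neq0 AU AG BA BB BA' BB' B'E Zv BU UB GB BG phiE.
case: n => [|n]; first by rewrite !expr0 mulr1 !mul1mx.
rewrite (qcomm_exprDn _ BA BB) (qcomm_exprDn _ BA' BB') !(mulmxDl, mulmxDr).
congr (_ + _).
  rewrite !mulmxA; congr (_ *m v).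
  by rewrite exprMn_comm // mulmxE !mulrA (commrX n.+1 (commr_sym AG)).
have BUn m : B * U ^+ m = y ^- m *: B.
  elim: m => [|m IHm]; first by rewrite expr0 invr1 mulr1 scale1r.
  by rewrite exprS mulrA BU -[LHS]scalemxAl mulmxE IHm scalerA -invfM -exprS.
have UnB m : U ^+ m * B = y ^+ m *: B.
  elim: m => [|m IHm]; first by rewrite !expr0 mul1r scale1r.
  by rewrite exprSr -mulrA UB -[LHS]scalemxAr mulmxE IHm scalerA -exprS.
have B'v : B' *m v = (nu / y * zeta) *: (B *m v).
  by rewrite B'E -!mulmxE -scalemxAl -mulmxA Zv -scalemxAr scalerA.
rewrite -!scalemxAl -!scalemxAr -[in RHS]mulmxA B'v -!scalemxAr scalerA.
have -> : A ^+ n * B *m (G * U ^+ n.+1 *m v) = (phi' / y ^+ n.+1) *: (A ^+ n *m (B *m v)).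
  rewrite !mulmxA -?mulmxE; set X := A ^+ n.
  have -> : X *m B *m G *m U ^+ n.+1 = (phi' / y ^+ n.+1) *: (X *m B).
    rewrite -!mulmxA [B *m _]mulmxA [B *m G]BG -scalemxAl [B *m _]BUn scalerA.
    by rewrite -scalemxAr.
  by rewrite -!scalemxAl.
have -> : G *m ((A * U) ^+ n *m (B *m v)) = (y ^+ n * phi) *: (A ^+ n *m (B *m v)).
  rewrite exprMn_comm // !mulmxA -?mulmxE.
  have -> : G *m A ^+ n *m U ^+ n *m B = (y ^+ n * phi) *: (A ^+ n *m B).
    rewrite -mulmxA [_ ^+ n *m B]UnB -scalemxAr [G *m _](commrX n (commr_sym AG)).
    by rewrite -mulmxE -mulmxA [G *m B]GB -scalemxAr scalerA.
  by rewrite -!scalemxAl.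
rewrite !scalerA geometric_inv // phiE; congr (_ *: _).
set c := (\sum_(i < n.+1) _); rewrite mulnC exprM (exprS y n).
by field; rewrite y_neq0 expf_neq0.
Qed.

End QCommutation.

(** * The ladder generators on sites read in a given order *)

Section Chain.
Variables (F : fieldType) (L : nat) (r : F) (s : pm).
Hypothesis r_neq0 : r != 0.
Local Notation q := (r ^+ 2).
Implicit Types (rho : 'I_L -> nat) (i j k l m : 'I_L).

(* The summand of [S^pm] at site [j], for the sites read in the order given by [rho]. *)
Definition ladder_term rho j : 'M[F]_(tdim L) :=
  tensop (fun i => if i == j then ladder F s
                   else if (rho i < rho j)%N then diag2 r r^-1 else diag2 r^-1 r).

(** The site [l] directly follows [k] in the order [rho]. The terms at [k] and [l] together form the
    two-site coproduct; any other term has equal diagonal factors at [k] and [l], hence commutes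
    with the bond by itself. *)
Lemma ladder_sum_hop w rho (c : 'I_L -> F) a k l :
  injective rho -> rho l = (rho k).+1 -> a != 0 -> c k = spow s a * c l ->
  (\sum_j c j *: ladder_term rho j) *m hop w q a k l
  = hop w q a k l *m (\sum_j c j *: ladder_term rho j).
Proof.
move=> rho_inj rho_l a_neq0 c_k.
have neq_kl : k != l by apply: contra_eq_neq rho_l => ->; rewrite neq_ltn ltnSn.
rewrite (bigD1 k) //= (bigD1 l) /=; last by rewrite eq_sym.
rewrite addrA mulmxDl mulmxDr; congr (_ + _).
  (* One background serves both terms: a site other than [k] and [l] precedes [l] exactly when it
     precedes [k]. *)
  pose u i := if (rho i < rho k)%N then diag2 r r^-1 else diag2 r^-1 r.
  have -> : ladder_term rho k = place u k l (ladder F s) (diag2 r^-1 r).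
    apply: eq_tensop => i; case: eqP => // _; rewrite /u; case: eqP => // ->.
    by rewrite rho_l ltnNge leqnSn.
  have -> : ladder_term rho l = place u k l (diag2 r r^-1) (ladder F s).
    apply: eq_tensop => i; have [->|neq_ik] := eqVneq i k.
      by rewrite (negPf neq_kl) rho_l ltnSn.
    case: eqP => // _; rewrite rho_l ltnS leq_eqVlt /u.
    by rewrite (inj_eq rho_inj) (negPf neq_ik).
  apply: hop_intertwine => // i j i' j'.
  by rewrite c_k mulrAC mulrC -mulrDr hop_defect_ladder ?mulr0.
rewrite mulmx_suml mulmx_sumr; apply: eq_bigr => j /andP[neq_jk neq_jl].
rewrite -[LHS]scalemxAl -[RHS]scalemxAr; congr (_ *: _).
pose d := if (rho k < rho j)%N then diag2 r r^-1 else diag2 r^-1 r.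
pose u i := if i == j then ladder F s
            else if (rho i < rho j)%N then diag2 r r^-1 else diag2 r^-1 r.
have -> : ladder_term rho j = place u k l d d.
  apply: eq_tensop => i.
  have [->|neq_ik] := eqVneq i k; first by rewrite eq_sym (negPf neq_jk).
  have [->|//] := eqVneq i l; rewrite eq_sym (negPf neq_jl) rho_l /d.
  by rewrite [in RHS]leq_eqVlt -rho_l (inj_eq rho_inj) eq_sym (negPf neq_jl).
apply: hop_intertwine1 => // i j0 i' j'.
by rewrite /d; case: ifP => _; rewrite hop_defect_diag2 // 1?[r * _]mulrC.
Qed.

Lemma at_site_tensop k A (u : 'I_L -> 'M[F]_2) :
  at_site k A *m tensop u = tensop (fun i => if i == k then A *m u i else u i).
Proof. by rewrite tensop_mul; apply: eq_tensop => i; case: eqP => _; rewrite ?mul1mx. Qed.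

Lemma tensop_at_site k A (u : 'I_L -> 'M[F]_2) :
  tensop u *m at_site k A = tensop (fun i => if i == k then u i *m A else u i).
Proof. by rewrite tensop_mul; apply: eq_tensop => i; case: eqP => _; rewrite ?mulmx1. Qed.

Lemma diag2C (x y x' y' : F) : diag2 x y *m diag2 x' y' = diag2 x' y' *m diag2 x y.
Proof. by rewrite !mul_diag2 mulrC [y * _]mulrC. Qed.

Lemma prod_at1 k (x : F) : \prod_i (if i == k then x else 1) = x.
Proof. by rewrite -big_mkcond big_pred1_eq. Qed.

Lemma prod_at2 k l (x y : F) : k != l ->
  \prod_i (if i == k then x else if i == l then y else 1) = x * y.
Proof.
move=> neq_kl; rewrite (bigD1 k) //= eqxx; congr (_ * _).
rewrite -[RHS](prod_at1 l) [in RHS](bigD1 k) //= (negPf neq_kl) mul1r.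
by apply: eq_bigr => i /negPf->.
Qed.

Local Notation y := (spow s q).

Lemma spow_neq0 (x : F) : x != 0 -> spow s x != 0.
Proof. by rewrite /spow; case: s => //; rewrite invr_eq0. Qed.

Lemma spowX (x : F) n : spow s (x ^+ n) = spow s x ^+ n.
Proof. by rewrite /spow; case: s => //; rewrite exprVn. Qed.

Lemma spowV (x : F) : spow s x^-1 = (spow s x)^-1.
Proof. by rewrite /spow; case: s. Qed.

Let sr_neq0 : spow s r != 0 := spow_neq0 r_neq0.
Let q_neq0 : q != 0. Proof. by rewrite expf_neq0. Qed.

Lemma ladder_term_sq rho j : ladder_term rho j *m ladder_term rho j = 0.
Proof.
by rewrite tensop_mul; apply: (@tensop_eq0 _ _ _ j); rewrite eqxx ladder2.
Qed.

(** Each of the sites [j] and [m] contributes a factor [y], from exchanging a ladder matrix with a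
    diagonal one; at all other sites the factors are diagonal and commute. *)
Lemma ladder_termC rho j m : (rho j < rho m)%N ->
  ladder_term rho m *m ladder_term rho j
  = y ^+ 2 *: (ladder_term rho j *m ladder_term rho m).
Proof.
move=> lt_jm; rewrite !tensop_mul.
have neq_jm : j != m by apply: contraTneq lt_jm => ->; rewrite ltnn.
have -> : y ^+ 2 = \prod_i (if i == j then y else if i == m then y else 1).
  by rewrite prod_at2.
apply: tensop_scale => i; have [->|neq_ij] := eqVneq i j.
  rewrite (negPf neq_jm) lt_jm diag2_ladder // ladder_diag2 // scalerA spowX.
  by congr (_ *: _); field.
have [->|neq_im] := eqVneq i m; last first.
  by rewrite scale1r; do 2 case: ifP => _ //; rewrite diag2C.
rewrite ltnNge (ltnW lt_jm) /= -[r in diag2 _ r]invrK.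
rewrite diag2_ladder ?ladder_diag2 ?invr_eq0 // scalerA spowX spowV invrK.
by congr (_ *: _); field.
Qed.

(* [q ^ (- sum_k sigma^z_k)], a scalar on each sector of fixed particle number. *)
Definition charge_inv : 'M[F]_(tdim L) := tensop (fun=> diag2 q^-1 q).

(** Conservation of the particle number: equal diagonal factors at both ends leave the weight
    unchanged. *)
Lemma charge_inv_hop w a k l : k != l ->
  charge_inv *m hop w q a k l = hop w q a k l *m charge_inv.
Proof.
move=> neq_kl.
have -> : charge_inv = place (fun=> diag2 q^-1 q) k l (diag2 q^-1 q) (diag2 q^-1 q).
  by apply: eq_tensop => i; rewrite !if_same.
apply: hop_intertwine1 => // i j i' j'.
by apply: hop_defect_diag2; congr (_ * _); exact: mulrC.
Qed.

Lemma charge_inv_at_site k x x' :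
  charge_inv *m at_site k (diag2 x x') = at_site k (diag2 x x') *m charge_inv.
Proof.
rewrite at_site_tensop tensop_at_site.
by apply: eq_tensop => i; case: ifP; rewrite // diag2C.
Qed.

(** A gauge transformation at one end of the bond; this is how the boundary weight gets its factors
    [beta] and [q^(2n)]. *)
Lemma at_site_diag2_hop w a x x' k l : k != l -> x != 0 -> x' != 0 -> a != 0 ->
  at_site k (diag2 x x') *m hop w q a k l
  = hop w q (a * x / x') k l *m at_site k (diag2 x x').
Proof.
move=> neq_kl x_neq0 x'_neq0 a_neq0.
have -> : at_site k (diag2 x x') = place (fun=> 1%:M) k l (diag2 x x') (diag2 1 1).
  by apply: eq_tensop => i; rewrite diag2_1 if_same.
apply: hop_intertwine1 => // i j i' j'; apply: hop_defect_diag2; field => //.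
by rewrite a_neq0 x_neq0 x'_neq0.
Qed.

Lemma at_site_mul k A B : at_site k A *m at_site k B = at_site k (A *m B) :> 'M[F]_(tdim L).
Proof. by rewrite tensop_mul; apply: eq_tensop => i; case: ifP; rewrite ?mulmx1. Qed.

Lemma at_site1 k : at_site k 1%:M = 1%:M :> 'M[F]_(tdim L).
Proof. by rewrite -tensop1; apply: eq_tensop => i; rewrite if_same. Qed.

Lemma at_site_diag2X k x x' n :
  at_site k (diag2 x x') ^+ n = at_site k (diag2 (x ^+ n) (x' ^+ n)) :> 'M[F]_(tdim L).
Proof.
elim: n => [|n IHn]; first by rewrite !expr0 diag2_1 at_site1.
by rewrite exprS IHn -mulmxE at_site_mul mul_diag2 -!exprS.
Qed.

Lemma at_site_term rho j m x x' : j != m ->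
  at_site m (diag2 x x') *m ladder_term rho j = ladder_term rho j *m at_site m (diag2 x x').
Proof.
move=> neq_jm; rewrite at_site_tensop tensop_at_site; apply: eq_tensop => i.
by case: eqP => // ->; rewrite eq_sym (negPf neq_jm); case: ifP => _; rewrite diag2C.
Qed.

Lemma at_site_ladder rho m x x' :
  at_site m (diag2 x x') *m ladder_term rho m
  = (if s is Plus then x else x') *: ladder_term rho m.
Proof.
rewrite at_site_tensop -[X in X *: _](prod_at1 m); apply: tensop_scale => i.
case: eqP => _; last by rewrite scale1r.
by rewrite /ladder; case: s; rewrite mul_diag2_sigma.
Qed.

Lemma ladder_at_site rho m x x' :
  ladder_term rho m *m at_site m (diag2 x x')
  = (if s is Plus then x' else x) *: ladder_term rho m.
Proof.
rewrite tensop_at_site -[X in X *: _](prod_at1 m); apply: tensop_scale => i.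
case: eqP => _; last by rewrite scale1r.
by rewrite /ladder; case: s; rewrite mul_diag2_sigma.
Qed.

(* [rho'] moves site [m] from the last to the first position of the order [rho]. *)
Section Rotation.
Variables (m : 'I_L) (rho rho' : 'I_L -> nat).
Hypothesis rho_m : forall i, i != m -> (rho i < rho m)%N.
Hypothesis rho'_m : forall i, i != m -> (rho' m < rho' i)%N.
Hypothesis rhoE : forall i j, i != m -> j != m -> (rho i < rho j)%N = (rho' i < rho' j)%N.

(** Once [m] comes first instead of last, its factor [q^(-sigma^z/2)] becomes [q^(sigma^z/2)]; the
    relative order of the other sites is kept. *)
Lemma rotate_other_term j : j != m ->
  ladder_term rho' j = ladder_term rho j *m at_site m (diag2 q q^-1).
Proof.
move=> neq_jm; rewrite tensop_at_site; apply: eq_tensop => i.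
have [->|neq_im] := eqVneq i m; last by rewrite rhoE.
rewrite eq_sym (negPf neq_jm) rho'_m // ltnNge ltnW ?rho_m //= mul_diag2.
by congr diag2; field.
Qed.

(** Every other site passes from before [m] to after it and gains [q^(-sigma^z)]. Completing these
    factors to [charge_inv] adds one at [m], where the ladder matrix turns it into [y]; hence
    [y^-1]. *)
Lemma rotate_term : ladder_term rho' m = y^-1 *: (ladder_term rho m *m charge_inv).
Proof.
rewrite tensop_mul -[y^-1](prod_at1 m); apply: tensop_scale => i.
have [_|neq_im] := eqVneq i m.
  rewrite -[q in diag2 _ q]invrK.
  by rewrite ladder_diag2 ?invr_eq0 // spowV invrK scalerA mulVf ?scale1r ?spow_neq0.
rewrite ltnNge ltnW ?rho'_m // rho_m //= mul_diag2 scale1r.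
by congr diag2; field.
Qed.

End Rotation.

End Chain.

(** * Bulk and boundary bonds of the ring *)

Section Ring.
Variables (F : fieldType) (L : nat) (r w : F) (s : pm).
Hypothesis L_gt0 : (0 < L)%N.
Hypothesis r_neq0 : r != 0.
Local Notation q := (r ^+ 2).
Local Notation first := (ord0 : 'I_L.+1).
Local Notation last := (ord_max : 'I_L.+1).
Variable c : 'I_L.+1 -> F.

Definition ladder_sum : 'M[F]_(tdim L.+1) :=
  \sum_j c j *: ladder_term r s (fun i => i) j.

Lemma ladder_sum_bulk_hop a (k l : 'I_L.+1) :
  l = k.+1 :> nat -> a != 0 -> c k = spow s a * c l ->
  ladder_sum *m hop w q a k l = hop w q a k l *m ladder_sum.
Proof. by move=> l_k; apply: ladder_sum_hop => //; exact: ord_inj. Qed.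

(** The rotated operator [S'] commutes with the boundary bond of weight [a], and [key] carries this
    over to [ladder_sum] on the [charge_inv] eigenspace. Here [nu] corrects the coefficient of the
    last site after rotation, and [spow s b * nu * zeta = 1] fixes the gauge factor [b]. *)
Lemma boundary_hop_intertwine a b nu zeta n (v : 'cV[F]_(tdim L.+1)) :
  a != 0 -> b != 0 -> nu * c last = spow s a * c first -> spow s b * nu * zeta = 1 ->
  charge_inv L.+1 r *m v = zeta *: v ->
  ladder_sum ^+ n *m (hop w q (q ^+ (2 * n) * (a * b)) last first *m v)
  = hop w q (a * b) last first *m (ladder_sum ^+ n *m v).
Proof.
move=> a_neq0 b_neq0 c_last nuE Zv.
have q_neq0 : q != 0 by rewrite expf_neq0.
have neq_lf : last != first by rewrite -val_eqE /= -lt0n.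
pose rho (i : 'I_L.+1) : nat := i.
(* In this order [first] comes right after [last], so the boundary bond joins consecutive sites. *)
pose rho' (i : 'I_L.+1) : nat := if i == last then 0 else i.+1.
have rho_m i : i != last -> (rho i < rho last)%N.
  by move=> neq_i; rewrite /rho /= ltn_neqAle -ltnS ltn_ord andbT.
have rho'_m i : i != last -> (rho' last < rho' i)%N.
  by move=> /negPf neq_i; rewrite /rho' neq_i eqxx.
have rhoE i j : i != last -> j != last -> (rho i < rho j)%N = (rho' i < rho' j)%N.
  by move=> /negPf neq_i /negPf neq_j; rewrite /rho' neq_i neq_j.
have rho'_inj : injective rho'.
  move=> i j; rewrite /rho'; case: eqP => [->|_]; case: eqP => [->|_] //.
  by case=> /val_inj.
pose c' j := if j == last then nu * c j else c j.
pose S' := \sum_j c' j *: ladder_term r s rho' j.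
have S'_hop : S' *m hop w q a last first = hop w q a last first *m S'.
  apply: (@ladder_sum_hop _ _ _ _ r_neq0 w rho') => //.
    by rewrite /rho' eqxx eq_sym (negPf neq_lf).
  by rewrite /c' eqxx eq_sym (negPf neq_lf).
pose A := \sum_(j | j != last) c j *: ladder_term r s rho j.
pose B := c last *: ladder_term r s rho last.
pose B' := (nu * c last) *: ladder_term r s rho' last.
pose U : 'M[F]_(tdim L.+1) := at_site last (diag2 q q^-1).
pose G : 'M[F]_(tdim L.+1) := at_site last (diag2 b 1).
have AE x x' : A * at_site last (diag2 x x') = at_site last (diag2 x x') * A.
  rewrite mulr_suml mulr_sumr; apply: eq_bigr => j neq_j.
  by rewrite -[LHS]scalemxAl -[RHS]scalemxAr -at_site_term.
have SE : ladder_sum = A + B by rewrite /ladder_sum (bigD1 last) //= addrC.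
have AUE : A * U = \sum_(j | j != last) c j *: ladder_term r s rho' j.
  rewrite mulr_suml; apply: eq_bigr => j neq_j.
  by rewrite -[LHS]scalemxAl -(rotate_other_term _ _ rho_m rho'_m rhoE).
have S'E : S' = A * U + B'.
  rewrite AUE /S' (bigD1 last) //= addrC /c' eqxx; congr (_ + _).
  by apply: eq_bigr => j /negPf ->.
pose y := spow s q.
have y_neq0 : y != 0 by rewrite spow_neq0.
have key (u : 'cV_(tdim L.+1)) : charge_inv L.+1 r *m u = zeta *: u ->
    ladder_sum ^+ n *m (G * U ^+ n *m u) = G *m (S' ^+ n *m u).
  move=> Zu; rewrite SE S'E.
  (* [G] meets the ladder matrix with its entry [b] on the left and [1] on the right for [Plus], and
     the other way round for [Minus]; the relation between [phi] and [phi'] then becomes [nuE] for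
     either sign. *)
  apply: (@twisted_power _ _ A B B' U G _ u y (if s is Plus then b else 1)
    (if s is Plus then 1 else b) nu zeta n y_neq0 (AE _ _) (AE _ _) _ _ _ _ _ Zu).
  - rewrite mulr_sumr mulr_suml scaler_sumr; apply: eq_bigr => j neq_j.
    rewrite -[LHS]scalemxAl -[_ * _ in RHS]scalemxAl -!scalemxAr.
    rewrite ladder_termC ?rho_m // !scalerA; congr (_ *: _).
    by rewrite -/y; ring.
  - by rewrite -[LHS]scalemxAl -scalemxAr ladder_term_sq !scaler0.
  - rewrite AUE mulr_sumr mulr_suml scaler_sumr; apply: eq_bigr => j neq_j.
    rewrite -[LHS]scalemxAl -[_ * _ in RHS]scalemxAl -!scalemxAr.
    have -> := ladder_termC s r_neq0 (rho'_m _ neq_j).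
    rewrite !scalerA; congr (_ *: _).
    by rewrite -/y; field.
  - by rewrite -[LHS]scalemxAl -scalemxAr ladder_term_sq !scaler0.
  - rewrite /B' (rotate_term _ _ rho_m rho'_m) // -[B * _]scalemxAl !scalerA.
    by rewrite -/y mulrAC.
  - rewrite -[LHS]scalemxAl ladder_at_site scalerA [RHS]scalerA mulrC.
    by rewrite /y /spow; case: s; rewrite ?invrK.
  - rewrite -[LHS]scalemxAr at_site_ladder scalerA [RHS]scalerA mulrC.
    by rewrite /y /spow; case: s.
  - by rewrite -[LHS]scalemxAr at_site_ladder scalerA [RHS]scalerA mulrC.
  - by rewrite -[LHS]scalemxAl ladder_at_site scalerA [RHS]scalerA mulrC.
  - move: nuE; rewrite /spow; case: s => [<- //|nuE].
    by apply: (mulfI (invr_neq0 b_neq0)); rewrite mulVf // mul1r mulrA nuE.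
have DE : G * U ^+ n = at_site last (diag2 (b * q ^+ n) (q ^- n)).
  by rewrite at_site_diag2X [LHS]at_site_mul mul_diag2 mul1r exprVn.
(* The inverse of [G * U ^+ n] applied to [v]. Being diagonal, it keeps the vector in the same
   eigenspace of [charge_inv]. *)
pose u := at_site last (diag2 (b * q ^+ n)^-1 (q ^+ n)) *m v.
have vE : v = G * U ^+ n *m u.
  rewrite DE mulmxA at_site_mul mul_diag2 mulfV ?mulVf ?mulf_neq0 ?expf_neq0 //.
  by rewrite diag2_1 at_site1 mul1mx.
have Zu : charge_inv L.+1 r *m u = zeta *: u.
  by rewrite mulmxA charge_inv_at_site -mulmxA Zv -scalemxAr.
clearbody u.
have Zhu : charge_inv L.+1 r *m (hop w q a last first *m u)
    = zeta *: (hop w q a last first *m u).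
  by rewrite mulmxA charge_inv_hop // -mulmxA Zu -scalemxAr.
(* The ratio of the two diagonal entries of [G * U ^+ n] is [b * q^(2n)]. *)
have qE : q ^+ (2 * n) * (a * b) = a * (b * q ^+ n) / q ^- n.
  by rewrite invrK mulnC exprM; ring.
have -> : hop w q (q ^+ (2 * n) * (a * b)) last first *m v
    = G * U ^+ n *m (hop w q a last first *m u).
  rewrite [in LHS]vE DE !mulmxA; congr (_ *m u).
  by rewrite at_site_diag2_hop ?mulf_neq0 ?invr_neq0 ?expf_neq0 // qE.
have S'n_hop : S' ^+ n *m hop w q a last first = hop w q a last first *m S' ^+ n.
  by apply: commr_sym; apply: commrX; apply: commr_sym.
(* [key] is used for [u] and for the bond applied to [u]. It remains to move the bond past
   [S' ^+ n], at weight [a], and then past [G], which raises the weight to [a * b]. *)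
rewrite [in RHS]vE !key // [in LHS]mulmxA [in LHS]mulmxA -[in LHS](mulmxA G) S'n_hop.
by rewrite [in LHS]mulmxA at_site_diag2_hop ?oner_neq0 // divr1 -!mulmxA.
Qed.

End Ring.

(** * Exponentials of diagonal matrices *)

Section Exponential.
Variable R : realType.
Local Notation C := R[i].
Local Notation toC := (real_complex R).
Local Notation K := (C : numFieldType).

Lemma cvg_real_complex (f : nat -> R) (l : R) :
  (f @ \oo --> l)%classic -> ((fun n => toC (f n) : K) @ \oo --> (toC l : K))%classic.
Proof.
move=> /cvgrPdist_lt fl; apply/cvgrPdist_lt => e e_gt0.
(* A positive element of the complex numbers is real, so its real part serves as the radius. *)
have [im_e re_e] : complex.Im e = 0 /\ 0 < complex.Re e.
  by case: e e_gt0 => a b; rewrite ltcE /= => /andP[/eqP].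
have [N _ fN] := fl _ re_e.
exists N => // n Nn; rewrite -rmorphB normc_def /= expr0n /= addr0 sqrtr_sqr.
by rewrite ltcE /= im_e eqxx fN.
Qed.

Lemma diag_mx_expr (F : pzRingType) n (d : 'rV[F]_n) p :
  diag_mx d ^+ p = diag_mx (\row_j d 0 j ^+ p).
Proof.
elim: p => [|p IHp].
  by apply/matrixP => i j; rewrite expr0 !mxE expr0.
rewrite exprS IHp -mulmxE mulmx_diag; congr diag_mx.
by apply/rowP => j; rewrite !mxE exprS.
Qed.

(** Powers of a diagonal matrix are diagonal, so each entry is the scalar exponential series times
    the indicator of the diagonal. *)
Lemma expmx_diag n (d : 'I_n -> R) :
  expmx (diag_mx (\row_j toC (d j))) = diag_mx (\row_j toC (expR (d j))).
Proof.
apply/matrixP => i j; rewrite [LHS]mxE.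
rewrite [RHS]mxE [X in X *+ _]mxE.
have termE p : p`!%:R^-1 * (diag_mx (\row_j toC (d j)) ^+ p) i j
    = toC (exp_coeff (d i) p *+ (i == j)).
  rewrite diag_mx_expr !mxE exp_coeffE mulrnAr rmorphMn.
  by congr (_ *+ _); rewrite rmorphM fmorphV rmorph_nat rmorphXn.
under eq_fun => N do under eq_bigr => p _ do rewrite termE.
rewrite -rmorphMn; apply: cvg_lim => //.
under eq_fun => N do rewrite -rmorph_sum.
apply: cvg_real_complex.
under eq_fun => N do rewrite sumrMnl.
case: (i == j); last exact: cvg_cst.
exact: is_cvg_series_exp_coeff.
Qed.

Lemma tensop_diag (F : fieldType) n (d d' : 'I_n -> F) :
  tensop (fun i => diag2 (d i) (d' i))
  = diag_mx (\row_x \prod_i (if digit x i == 0 then d i else d' i)).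
Proof.
have diagE i (a b : 'I_2) :
    diag2 (d i) (d' i) a b = (if a == 0 then d i else d' i) *+ (a == b).
  rewrite !mxE; case: a => [[|[|//]] ?]; case: b => [[|[|//]] ?];
  by rewrite /= ?mulr1 ?mulr0 ?addr0 ?add0r ?mulr0n.
apply/matrixP => x y; rewrite tensopE !mxE.
have [<-|neq_xy] := eqVneq x y.
  by rewrite mulr1n; apply: eq_bigr => i _; rewrite diagE eqxx mulr1n.
have [i xy_i] := digit_neq neq_xy.
by rewrite (bigD1 i) //= diagE (negPf xy_i) !mulr0n mul0r.
Qed.

Lemma at_site_diag (F : fieldType) n (k : 'I_n) (a b : F) :
  at_site k (diag2 a b) = diag_mx (\row_x (if digit x k == 0 then a else b)).
Proof.
have -> : at_site k (diag2 a b)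
    = tensop (fun i => diag2 (if i == k then a else 1) (if i == k then b else 1)).
  by apply: eq_tensop => i; case: eqP => _ //; rewrite diag2_1.
rewrite tensop_diag; congr diag_mx; apply/rowP => x; rewrite !mxE.
rewrite (bigD1 k) //= eqxx big1 ?mulr1 // => i /negPf ->.
by rewrite if_same.
Qed.

(** The exponent is diagonal with a sum over sites in each entry; the scalar exponential turns this
    sum into a product, which is the entry of a product operator. *)
Lemma powmx_sigma_z (q : R) n (c : 'I_n -> R) : 0 < q ->
  powmx q (\sum_i toC (c i) *: at_site i sigma_z)
  = tensop (fun i => diag2 (toC (q `^ c i)) (toC (q `^ (- c i)))).
Proof.
move=> q_gt0; rewrite /powmx.
have -> : toC (ln q) *: (\sum_i toC (c i) *: at_site i sigma_z)
    = diag_mx (\row_x toC (\sum_i (if digit x i == 0 then c i else - c i) * ln q)).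
  apply/matrixP => x y; rewrite !mxE summxE -mulr_suml rmorphM rmorph_sum mulrC /=.
  rewrite -mulrnAl; congr (_ * _); rewrite -sumrMnl; apply: eq_bigr => i _.
  have -> : sigma_z = diag2 1 (- 1) :> 'M[C]_2 by rewrite /diag2 scale1r scaleN1r.
  rewrite mxE at_site_diag !mxE mulrnAr; congr (_ *+ _).
  by case: ifP => _; rewrite ?mulr1 ?mulrN1 ?rmorphN.
rewrite expmx_diag tensop_diag; congr diag_mx; apply/rowP => x; rewrite !mxE.
rewrite expR_sum rmorph_prod; apply: eq_bigr => i _.
by case: eqP => _ /=; rewrite /powR gt_eqF.
Qed.

End Exponential.

(** * Identification of the abstract chain with the ASEP operators *)

Section ASEPChain.
Variables (R : realType) (L : nat) (q alpha : R) (s : pm).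
Hypotheses (q_gt0 : 0 < q) (alpha_gt0 : 0 < alpha).
Local Notation C := R[i].
Local Notation toC := (real_complex R).
Local Notation r := (toC (q `^ 2^-1)).
Local Notation first := (ord0 : 'I_L.+1).
Local Notation last := (ord_max : 'I_L.+1).

Definition ladder_coef (j : 'I_L.+1) : C :=
  toC (alpha `^ ((pmz s)%:~R * (2^-1 * (L.+1%:R + 1 - 2 * j.+1%:R)))).

Lemma sqrt_q_sqr : r ^+ 2 = toC q.
Proof. by rewrite -rmorphXn -powR_mulrn ?powR_ge0 // -powRrM mulVf ?pnatr_eq0 // powRr1 // ltW. Qed.

Lemma sqrt_q_neq0 : r != 0.
Proof. by rewrite -(rmorph0 toC) (inj_eq (@complexI _)) gt_eqF ?powR_gt0. Qed.

Lemma ladder_term_powmx (j : 'I_L.+1) :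
  powmx q (2^-1 *: (\sum_(1 <= i < j.+1) site L.+1 sigma_z i)
           - 2^-1 *: (\sum_(j.+2 <= i < L.+2) site L.+1 sigma_z i))
    *m site L.+1 (sigma_pm R s) j.+1 = ladder_term r s (fun i => i) j.
Proof.
(* The exponent of [q] at each site; it vanishes at [j], where only the ladder matrix acts. *)
pose e (i : 'I_L.+1) : R := if (i < j)%N then 2^-1 else if (j < i)%N then - 2^-1 else 0.
have -> : 2^-1 *: (\sum_(1 <= i < j.+1) site L.+1 sigma_z i)
           - 2^-1 *: (\sum_(j.+2 <= i < L.+2) site L.+1 sigma_z i)
        = \sum_(i < L.+1) toC (e i) *: at_site i sigma_z :> 'M[C]_(tdim L.+1).
  rewrite big_add1 /= big_mkord big_add1 /= big_geq_mkord.
  rewrite (big_ord_widen L.+1 (fun i => site L.+1 sigma_z i.+1)); last exact: ltnW.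
  rewrite !scaler_sumr -sumrN big_mkcond [X in _ + X]big_mkcond -big_split /=.
  (* The [2^-1] in [qS] is a complex scalar, whereas the exponents [e] are real. *)
  have half : 2^-1 = toC 2^-1 by rewrite fmorphV rmorph_nat.
  apply: eq_bigr => i _; rewrite siteE /e half; case: ltngtP => _.
  - by rewrite addr0.
  - by rewrite add0r -scaleNr -rmorphN.
  - by rewrite addr0 rmorph0 scale0r.
rewrite powmx_sigma_z // siteE tensop_at_site; apply: eq_tensop => i.
have rV : toC (q `^ (- 2^-1)) = r^-1 by rewrite powRN fmorphV.
have [->|neq_ij] := eqVneq i j.
  by rewrite /e ltnn oppr0 powRr0 diag2_1 mul1mx.
rewrite /e; case: ltngtP => [_|_|eq_ij].
- by rewrite rV.
- by rewrite opprK rV.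
- by case/eqP: neq_ij; exact: ord_inj.
Qed.

Lemma qSE : qS L.+1 s q alpha = ladder_sum r s ladder_coef.
Proof.
rewrite /qS big_add1 /= big_mkord; apply: eq_bigr => j _.
by rewrite -ladder_term_powmx.
Qed.

Lemma bondE w a (k l : 'I_L.+1) :
  bond L.+1 w q a k.+1 l.+1 = hop (toC w) (r ^+ 2) (toC a) k l.
Proof. by rewrite /bond /hop !siteE sqrt_q_sqr rmorphN !fmorphV. Qed.

Lemma asepHE w beta : asepH L.+1 w q alpha beta
  = \sum_(k < L) hop (toC w) (r ^+ 2) (toC alpha) (widen_ord (leqnSn L) k) (lift ord0 k)
    + hop (toC w) (r ^+ 2) (toC (alpha * beta)) last first.
Proof.
rewrite /asepH big_add1 big_mkord /= (bondE w (alpha * beta) last first).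
rewrite [in RHS](eq_bigr (fun k : 'I_L => bond L.+1 w q alpha k.+1 k.+2)); first by [].
by move=> k _; rewrite -bondE lift0.
Qed.

Lemma spow_toC (x : R) : 0 < x -> spow s (toC x) = toC (x `^ (pmz s)%:~R).
Proof.
move=> x_gt0; rewrite /spow; case: s; first by rewrite powRr1 // ltW.
by rewrite powR_inv1 ?ltW // fmorphV.
Qed.

Lemma alpha_powD x y : alpha `^ x * alpha `^ y = alpha `^ (x + y).
Proof. by rewrite powRD //; apply/implyP => _; rewrite gt_eqF. Qed.

(** The exponents of [alpha] at neighbouring sites differ by [pmz s], as the symmetry of a bond of
    weight [alpha] requires. *)
Lemma ladder_coef_step (k : 'I_L) :
  ladder_coef (widen_ord (leqnSn L) k) = spow s (toC alpha) * ladder_coef (lift ord0 k).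
Proof.
rewrite /ladder_coef spow_toC // -[RHS]rmorphM alpha_powD; congr (toC (_ `^ _)).
by rewrite lift0 -[in RHS](natr1 k.+1) /=; field.
Qed.

(** The [L] steps from the first to the last site and the one closing the ring each give a factor
    [spow s alpha]. The resulting [nu] is the source of the power of [alpha] in [beta_pm]. *)
Lemma ladder_coef_rotate :
  spow s (toC alpha ^+ L.+1) * ladder_coef last = spow s (toC alpha) * ladder_coef first.
Proof.
rewrite spowX /ladder_coef spow_toC // -[_ ^+ _]rmorphXn -[LHS]rmorphM -[RHS]rmorphM; congr toC.
rewrite -powR_mulrn ?powR_ge0 // -powRrM !alpha_powD; congr (_ `^ _).
by rewrite /= -(natr1 L); field.
Qed.

(** A hole contributes [q^-1] and a particle [q], both written as [q^-1 * q ^+ (2 * eta i)] so that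
    the product over sites only involves [K]. *)
Lemma charge_inv_ket (eta : config L.+1) K : eta \in config_num L.+1 K ->
  charge_inv L.+1 r *m ket C eta = toC (q ^+ (2 * K) / q ^+ L.+1) *: ket C eta.
Proof.
rewrite inE => /eqP etaK; rewrite /charge_inv /ket tensop_mulvec.
have -> : toC (q ^+ (2 * K) / q ^+ L.+1) = \prod_(i < L.+1) toC (q^-1 * q ^+ (2 * eta i)).
  rewrite -rmorph_prod big_split /= prodr_const card_ord prodrXr -big_distrr /= etaK.
  by rewrite exprVn mulrC.
apply: tensvec_scale => i; rewrite sqrt_q_sqr.
have q_neq0 : q != 0 by rewrite gt_eqF.
have -> : diag2 (toC q)^-1 (toC q) = toC q^-1 *: hole_op + toC q *: num_op.
  by rewrite /diag2 fmorphV.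
rewrite mulmxDl -!scalemxAl; case: (eta i) => [[|[|//]] ?].
  rewrite [Ordinal _](_ : _ = 0); last exact: val_inj.
  by rewrite mul_delta_mx mul_delta_mx_0 // scaler0 addr0 muln0 expr0 mulr1.
rewrite [Ordinal _](_ : _ = 1); last exact: val_inj.
rewrite mul_delta_mx mul_delta_mx_0 // scaler0 add0r; congr (toC _ *: _).
by rewrite muln1 expr2 mulKf.
Qed.

End ASEPChain.

Theorem proposition1 (R : realType) (L : nat) (hL : (2 <= L)%N)
    (q : R) (hq0 : 0 < q) (hq1 : q != 1) (w : R) (hw : w != 0)
    (alpha : R) (halpha : 0 < alpha)
    (K : nat) (hK : (K <= L)%N) (eta : config L) (heta : eta \in config_num L K)
    (n : nat) (hn : (n <= L - K)%N) (s : pm) :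
  (qS L s q alpha ^+ n
     *m asepH L w q alpha (q ^+ (2 * n) * beta_pm L s q alpha K)
   - asepH L w q alpha (beta_pm L s q alpha K) *m qS L s q alpha ^+ n)
  *m ket R[i] eta = 0.
Proof.
(* The ring now has [L.+1] sites, and [hL] amounts to [0 < L], which keeps the two ends of the
   boundary bond distinct. *)
case: L hL hK eta heta hn => // L hL _ eta heta _.
set beta := beta_pm _ _ _ _ _.
rewrite mulmxBl -!mulmxA qSE // !asepHE //.
have a_neq0 : real_complex R alpha != 0 by rewrite fmorph_eq0 gt_eqF.
have beta_neq0 : real_complex R beta != 0.
  by rewrite fmorph_eq0 mulf_neq0 ?expfz_neq0 ?invr_neq0 ?expf_neq0 ?gt_eqF.
set S := ladder_sum _ _ _; set H := \sum_(k < L) _; set v := ket _ _.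
have SH : H *m S ^+ n = S ^+ n *m H.
  apply: commrX; rewrite /GRing.comm -!mulmxE mulmx_suml [RHS]mulmx_sumr.
  apply: eq_bigr => k _; symmetry.
  apply: ladder_sum_bulk_hop.
  - exact: sqrt_q_neq0.
  - by rewrite lift0.
  - exact: a_neq0.
  - exact: ladder_coef_step.
have key : S ^+ n *m (hop (real_complex R w) (real_complex R (q `^ 2^-1) ^+ 2)
      (real_complex R (alpha * (q ^+ (2 * n) * beta))) ord_max ord0 *m v)
    = hop (real_complex R w) (real_complex R (q `^ 2^-1) ^+ 2)
        (real_complex R (alpha * beta)) ord_max ord0 *m (S ^+ n *m v).
  have -> : real_complex R (alpha * (q ^+ (2 * n) * beta))
      = (real_complex R (q `^ 2^-1) ^+ 2) ^+ (2 * n)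
        * (real_complex R alpha * real_complex R beta).
    by rewrite sqrt_q_sqr // mulrCA [LHS]rmorphM rmorphXn [X in _ * X]rmorphM.
  rewrite [real_complex R (alpha * beta)]rmorphM.
  apply: (@boundary_hop_intertwine _ _ _ _ _ _ _ _ _ _
    (spow s (real_complex R alpha ^+ L.+1)) _ _ _ a_neq0 beta_neq0 _ _
    (charge_inv_ket hq0 heta)).
  - exact: hL.
  - exact: sqrt_q_neq0.
  - exact: ladder_coef_rotate.
  have a_neq0' : alpha != 0 by rewrite gt_eqF.
  have q_neq0 : q != 0 by rewrite gt_eqF.
  have qE : q ^ (L.+1%:Z - 2 * K%:Z) * (q ^+ (2 * K) / q ^+ L.+1) = 1.
    rewrite expfzDr // -PoszM -invr_expz -!exprnP.
    by field; rewrite !expf_neq0.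
  (* The condition [spow s b * nu * zeta = 1] with [b] the boundary factor [beta], [nu] the signed
     power of [alpha ^+ L.+1] and [zeta] the eigenvalue of [charge_inv]; solved for [beta], it
     yields the formula of [beta_pm]. *)
  have scalarE : beta `^ (pmz s)%:~R * (alpha ^+ L.+1) `^ (pmz s)%:~R
      * (q ^+ (2 * K) / q ^+ L.+1) = 1.
    rewrite /beta /beta_pm; case: (s) => /=.
      rewrite !powRr1 ?mulr_ge0 ?exprz_ge0 ?invr_ge0 ?exprn_ge0 ?ltW // mul1r.
      by rewrite mulfVK ?expf_neq0.
    rewrite !powR_inv1 ?mulr_ge0 ?exprz_ge0 ?invr_ge0 ?exprn_ge0 ?ltW // mulN1r.
    by rewrite -invr_expz invfM !invrK mulfK ?expf_neq0.
  rewrite spow_toC ?mulr_gt0 ?exprz_gt0 ?invr_gt0 ?exprn_gt0 //.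
  rewrite -rmorphXn spow_toC ?exprn_gt0 //.
  have := congr1 (real_complex R) scalarE.
  by rewrite [LHS]rmorphM [X in X * _]rmorphM rmorph1.
exact: intertwineD SH key.
Qed.
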